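(* Let $m\ge 2$ be an integer, and let $\tilde f^{\mathrm{I}}_m:\Omega\to S^3_1$, the closed set $\mathcal{C}^{\mathrm{I}}_m\subset S^3_1$, the domains $A^\pm_m,B^\pm_m\subset\Omega^{\pm}$, the projection $\varPi$, the points $p_\pm,n_\pm$ and the notion of endpoint be as defined in the context. If $m$ is even (resp. odd), the set of endpoints of $\mathcal{C}^{\mathrm{I}}_m$ is $\{p_+,p_-,n_+,n_-\}$ (resp. $\{p_-,n_+,n_-\}$). More precisely, put $y:=\varPi\circ\tilde f^{\mathrm{I}}_m$ and let $\{\zeta_j=(r_j,\theta_j)\}_{j\ge1}$ be a sequence in $\Omega$ whose image under $\tilde f^{\mathrm{I}}_m$ is unbounded. Then the following cases occur: (1) $\lim_{j\to\infty}y(\zeta_j)=n_-$ holds when $\lim_{j\to\infty}r_j=+\infty$ (that is, $\{\zeta_j\}$ lies in $\Omega^+$ and diverges). (2) When $\lim_{j\to\infty}r_j=-\infty$ (that is, if $\{\zeta_j\}$ lies in $\Omega^-$ and diverges), $\lim_{j\to\infty}y(\zeta_j)$ is $p_+$ if $m$ is even, and $n_-$ if $m$ is odd. (3) When $r_j\to0$ and $\{\zeta_j\}$ is contained in $A^+_m$ (resp. $A^-_m$, $B^+_m$, $B^-_m$), the limit $\lim_{j\to\infty}y(\zeta_j)$ is as follows. For $m$ even: $p_-$ on $A^+_m$, $n_+$ on $A^-_m$, $n_+$ on $B^+_m$, $p_-$ on $B^-_m$. For $m$ odd: $p_-$ on $A^+_m$, $p_-$ on $A^-_m$, $n_+$ on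 $B^+_m$, $n_+$ on $B^-_m$.
   Context: $\mathbb{R}^4_1$ is Lorentz–Minkowski 4-space with coordinates $(t,x,y,z)$ and metric of signature $(-+++)$; $S^3_1=\{X\in\mathbb{R}^4_1;\langle X,X\rangle=1\}$ is de Sitter 3-space. Let $S^1=\mathbb{R}/2\pi\mathbb{Z}$, $\Omega^{\pm}=\{(r,\theta)\in\mathbb{R}\times S^1;\pm r>0\}$, $\Omega=\Omega^+\cup\Omega^-$. The map $\tilde f^{\mathrm{I}}_m=(x_0,x_1,x_2,x_3):\Omega\to S^3_1$ (components in the coordinates $(t,x,y,z)$) is given by $$x_0\pm x_3=\frac{m^2-1}{4m}r^{\pm1}\Bigl(2\cos m\theta-\frac{m\mp1}{m\pm1}r^m\Bigr),$$ $$x_1+\mathrm{i}x_2=\frac{(m-1)^2}{4m}e^{\mathrm{i}(m+1)\theta}+\frac{(m+1)^2}{4m}e^{-\mathrm{i}(m-1)\theta}-e^{\mathrm{i}\theta}\frac{m^2-1}{4m}r^m .$$ (Its restriction to $\Omega^+$, with complex parameter $re^{\mathrm{i}\theta}$, is the exceptional catenoid $f^{\mathrm{I}}_m$ of type I.) Put $\gamma_m(\theta)=\frac{(m-1)^2}{4m}e^{\mathrm{i}(m+1)\theta}+\frac{(m+1)^2}{4m}e^{-\mathrm{i}(m-1)\theta}\in\mathbb{C}\cong\mathbb{R}^2$, $\alpha_k=\frac{2k+1}{2m}\pi$, $L_k=\{(t,\gamma_m(\alpha_k),-t);t\in\mathbb{R}\}\subset S^3_1$ for $k=0,\dots,2m-1$,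 and $$\mathcal{C}^{\mathrm{I}}_m:=\tilde f^{\mathrm{I}}_m(\Omega)\cup L_0\cup\dots\cup L_{2m-1},$$ which is a closed subset of $S^3_1$. With $\epsilon=\operatorname{sgn}(r)$, $$A^\pm_m=\{(r,\theta)\in\Omega^\pm;\epsilon^m(r^m+2\cos m\theta)>0\},\qquad B^\pm_m=\{(r,\theta)\in\Omega^\pm;\epsilon^m(r^m+2\cos m\theta)<0\}.$$ The stereographic hollow ball model is given by $\varPi:S^3_1\to\mathbb{R}^3$, $\varPi(t,x,y,z)=\frac1\delta(x,y,z)$ with $\delta=t+\sqrt{2t^2+1}$; its image is $\mathcal{D}^3=\{\xi\in\mathbb{R}^3;\sqrt2-1<|\xi|<\sqrt2+1\}$. The ideal boundaries of $S^3_1$ are $\partial_\pm S^3_1=\{\xi\in\mathbb{R}^3;|\xi|=\sqrt2\mp1\}$. For a closed subset $\mathcal{A}\subset S^3_1$, an endpoint of $\mathcal{A}$ is an element of $\overline{\varPi(\mathcal{A})}\cap\partial\mathcal{D}^3$ (closure in $\mathbb{R}^3$), where $\partial\mathcal{D}^3=\partial_+S^3_1\cup\partial_-S^3_1$. Put $$p_\pm=\bigl(0,0,\pm(\sqrt2-1)\bigr)\in\partial_+S^3_1,\qquad n_\pm=\bigl(0,0,\pm(\sqrt2+1)\bigr)\in\partial_-S^3_1 .$$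
   Formalization: In case (3) the image sequence is required to tend to infinity, not merely be unbounded (false otherwise: in A^+ let θ_j alternate between 0 and π/(2m)); ''the following cases occur'' is stated as exhaustive after passing to a subsequence. *)

(* Defs.v *)
From HB Require Import structures.
From mathcomp Require Import all_boot all_order all_algebra.
From mathcomp Require Import complex.
From mathcomp Require Import all_classical all_reals all_analysis.
From mathcomp Require Import ring lra.
Import Order.TTheory GRing.Theory Num.Theory.
Import numFieldNormedType.Exports.

Set Implicit Arguments.
Unset Strict Implicit.
Unset Printing Implicit Defensive.

Local Open Scope classical_set_scope.
Local Open Scope complex_scope.
Local Open Scope ring_scope.

Section ExceptionalCatenoid.
Variable R : realType.

(* A point of R^4_1 is (t, x, y, z).  The sup norm and the product topology
   of this type are equivalent to the Euclidean ones. *)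
Definition lorentz (X Y : R * R * R * R) : R :=
  let: (t, x, y, z) := X in let: (t', x', y', z') := Y in
  - (t * t') + x * x' + y * y' + z * z'.

Definition deSitter : set (R * R * R * R) := [set X | lorentz X X = 1].

Definition expi (t : R) : R[i] := cos t +i* sin t.

(* A point (r, theta) of R x S^1 is given by r and any real representative
   theta of the class modulo 2 pi; everything below is 2 pi-periodic in
   theta, and every sequence in R x S^1 lifts to such pairs. *)
Definition Omega_pos : set (R * R) := [set p | 0 < p.1].
Definition Omega_neg : set (R * R) := [set p | p.1 < 0].
Definition Omega : set (R * R) := Omega_pos `|` Omega_neg.

Section FixedM.
Variable m : nat.

Definition x0_plus_x3 (r th : R) : R :=
  (m%:R ^+ 2 - 1) / (4 * m%:R) * r *
  (2 * cos (m%:R * th) - (m%:R - 1) / (m%:R + 1) * r ^+ m).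

Definition x0_minus_x3 (r th : R) : R :=
  (m%:R ^+ 2 - 1) / (4 * m%:R) * r^-1 *
  (2 * cos (m%:R * th) - (m%:R + 1) / (m%:R - 1) * r ^+ m).

Definition gamma (th : R) : R[i] :=
  ((m%:R - 1) ^+ 2 / (4 * m%:R))%:C * expi ((m%:R + 1) * th) +
  ((m%:R + 1) ^+ 2 / (4 * m%:R))%:C * expi (- ((m%:R - 1) * th)).

Definition x1_plus_ix2 (r th : R) : R[i] :=
  gamma th - expi th * ((m%:R ^+ 2 - 1) / (4 * m%:R) * r ^+ m)%:C.

Definition catenoid_map (p : R * R) : R * R * R * R :=
  let: (r, th) := p in
  ((x0_plus_x3 r th + x0_minus_x3 r th) / 2,
   complex.Re (x1_plus_ix2 r th),
   complex.Im (x1_plus_ix2 r th),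
   (x0_plus_x3 r th - x0_minus_x3 r th) / 2).

Definition alpha (k : nat) : R := (2 * k%:R + 1) / (2 * m%:R) * pi.

Definition lightline (k : nat) : set (R * R * R * R) :=
  [set (t, complex.Re (gamma (alpha k)), complex.Im (gamma (alpha k)), - t)
  | t in [set: R]].

Definition catenoid : set (R * R * R * R) :=
  catenoid_map @` Omega `|` \bigcup_(k in `I_(2 * m)) lightline k.

Definition signed_height (p : R * R) : R :=
  Num.sg p.1 ^+ m * (p.1 ^+ m + 2 * cos (m%:R * p.2)).

Definition A_pos : set (R * R) := Omega_pos `&` [set p | 0 < signed_height p].
Definition A_neg : set (R * R) := Omega_neg `&` [set p | 0 < signed_height p].
Definition B_pos : set (R * R) := Omega_pos `&` [set p | signed_height p < 0].
Definition B_neg : set (R * R) := Omega_neg `&` [set p | signed_height p < 0].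

End FixedM.

(* The hollow ball model; only its values on deSitter are meaningful. *)
Definition hollow_ball (X : R * R * R * R) : R * R * R :=
  let: (t, x, y, z) := X in
  let delta := t + Num.sqrt (2 * t ^+ 2 + 1) in
  (x / delta, y / delta, z / delta).

(* Euclidean norm, as opposed to the library's sup norm on products. *)
Definition norm3 (xi : R * R * R) : R :=
  let: (x, y, z) := xi in Num.sqrt (x ^+ 2 + y ^+ 2 + z ^+ 2).

Definition ideal_boundary_pos : set (R * R * R) :=
  [set xi | norm3 xi = Num.sqrt 2 - 1].
Definition ideal_boundary_neg : set (R * R * R) :=
  [set xi | norm3 xi = Num.sqrt 2 + 1].

(* Intended for closed subsets A of deSitter. *)
Definition endpoints (A : set (R * R * R * R)) : set (R * R * R) :=
  closure (hollow_ball @` A) `&` (ideal_boundary_pos `|` ideal_boundary_neg).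

Definition p_plus : R * R * R := (0, 0, Num.sqrt 2 - 1).
Definition p_minus : R * R * R := (0, 0, - (Num.sqrt 2 - 1)).
Definition n_plus : R * R * R := (0, 0, Num.sqrt 2 + 1).
Definition n_minus : R * R * R := (0, 0, - (Num.sqrt 2 + 1)).

(* |u_j| -> +oo, i.e., u eventually leaves every compact subset. *)
Definition diverges (u : nat -> R * R * R * R) : Prop :=
  `|u j| @[j --> \oo] --> +oo.

Lemma catenoid_sub_deSitter (m : nat) :
  (2 <= m)%N -> catenoid m `<=` deSitter.
Proof.
move=> hm.
have m1 : 1 < m%:R :> R by rewrite ltr1n.
have m0 : m%:R != 0 :> R by rewrite gt_eqF // (lt_trans _ m1).
have mB : m%:R - 1 != 0 :> R by rewrite subr_eq0 gt_eqF.
have mD : m%:R + 1 != 0 :> R by rewrite gt_eqF // addr_gt0 // (lt_trans _ m1).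
have E1 th : (m%:R + 1) * th = m%:R * th + th :> R by rewrite mulrDl mul1r.
have E2 th : (m%:R - 1) * th = m%:R * th - th :> R by rewrite mulrBl mul1r.
have key (a b k c s C S : R) : c ^+ 2 + s ^+ 2 = 1 -> C ^+ 2 + S ^+ 2 = 1 ->
  (a * (C * c - S * s) + b * (C * c + S * s) - k * c) ^+ 2 +
  (a * (S * c + C * s) - b * (S * c - C * s) - k * s) ^+ 2 =
  ((a + b) * C - k) ^+ 2 + (a - b) ^+ 2 * (1 - C ^+ 2).
  by move=> cs <-; rewrite -[RHS]mulr1 -cs; ring.
have subst (x y x' y' w d : R) : x' ^+ 2 + y' ^+ 2 = w -> x = x' -> y = y' ->
  w - d = 1 -> x ^+ 2 + y ^+ 2 - d = 1 by move=> <- -> ->.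
move=> X [[[r th] rth <-]|[k _ [t _ <-]]];
  rewrite /deSitter /lorentz /gamma /expi /=.
- have r0 : r != 0.
    by case: rth => /= h; [rewrite gt_eqF | rewrite lt_eqF].
  have := key ((m%:R - 1) ^+ 2 / (4 * m%:R)) ((m%:R + 1) ^+ 2 / (4 * m%:R))
    ((m%:R ^+ 2 - 1) / (4 * m%:R) * r ^+ m)
    _ _ _ _ (cos2Dsin2 th) (cos2Dsin2 (m%:R * th)).
  rewrite cosN sinN E1 E2 cosB sinB cosD sinD /x0_plus_x3 /x0_minus_x3.
  move: (cos _) (sin _) (cos th) (sin th) (r ^+ m) => C S c s p kE.
  have regroup (t x y z : R) : - (t * t) + x * x + y * y + z * z =
    x ^+ 2 + y ^+ 2 - (t * t - z * z) by ring.
  rewrite regroup; apply: (subst _ _ _ _ _ _ kE); [ring|ring|].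
  by field; rewrite r0 m0 mB mD.
- set th := alpha m k.
  have C0 : cos (m%:R * th) = 0.
    have -> : m%:R * th = pi / 2 + pi *+ k :> R.
      by rewrite /th /alpha -mulr_natr; field.
    by rewrite (alternatingn (@cosDpi R)) cos_pihalf mulr0.
  have := key ((m%:R - 1) ^+ 2 / (4 * m%:R)) ((m%:R + 1) ^+ 2 / (4 * m%:R)) 0
    _ _ _ _ (cos2Dsin2 th) (cos2Dsin2 (m%:R * th)).
  rewrite cosN sinN E1 E2 cosB sinB cosD sinD C0.
  move: (sin _) (cos th) (sin th) => S c s kE.
  have regroup (u x y : R) : - (u * u) + x * x + y * y + - u * - u =
    x ^+ 2 + y ^+ 2 by ring.
  rewrite -[LHS]subr0 regroup; apply: (subst _ _ _ _ _ _ kE); [ring|ring|].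
  by field.
Qed.

End ExceptionalCatenoid.

(* Main.v *)
Require Import Defs.
From mathcomp Require Import all_boot all_order all_algebra.
From mathcomp Require Import all_classical all_reals all_analysis.
From mathcomp Require Import complex ring lra.
Import Order.TTheory GRing.Theory Num.Theory.
Import numFieldNormedType.Exports.
Set Implicit Arguments.
Unset Strict Implicit.
Unset Printing Implicit Defensive.
Local Open Scope classical_set_scope.
Local Open Scope ring_scope.

(** In the null coordinates P = x0 + x3 and M = x0 - x3 the catenoid has time
    t = (P + M) / 2 and height z = (P - M) / 2.  If one of P, M tends to
    infinity and dominates the other one as well as x1 and x2, then the point
    X becomes asymptotically null along the z-axis, z / t tends to 1 or -1, and
    the hollow ball projection, whose denominator is t + sqrt (2 t^2 + 1),
    tends to the pole of an ideal boundary sphere determined by the sign of t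
    and by which of P, M dominates (hollow_ball_cvg_null).

    As |r| grows, P has order r^(m+1) with a negative coefficient, while x1, x2
    have order r^m and M has order r^(m-1): P dominates with the sign of
    - r^(m+1) (hollow_ball_catenoid_cvg_large).  As r stays bounded, P, x1 and
    x2 stay bounded, and with h = r^m + 2 cos (m theta) and a constant c > 0
    one has M = c h / r + O(r^(m-1)) (catenoid_bounded).  So if the image
    diverges then M diverges with the sign of h / r, which is constant on each
    of the four domains A and B (hollow_ball_catenoid_cvg_small).

    Exhaustiveness of the cases is an argument with ultrafilters: an
    ultrafilter decides every alternative, so along an ultrafilter on which
    the image diverges either r tends to an infinity, or r is bounded; in the
    latter case r tends to 0 and h has a fixed sign, since a lower bound on |r|
    or h = 0 would bound the image (ultra_catenoid_trichotomy).  Subsequences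
    are extracted from such an ultrafilter.

    For the endpoints, the Euclidean norm of the projection of a point of de
    Sitter space determines t^2, and it reaches the radii of the ideal
    boundaries only in the limit of infinite |t| (hollow_ball_gap).  Hence a
    filter on the closed set that projects to an endpoint makes |t| diverge;
    refined to an ultrafilter, it lives either on the image of the map, where
    the trichotomy applies, or on the light-like lines, where the limit is p_-
    or n_+.  Conversely, n_- and p_+ are reached along theta = 0, and p_- and
    n_+ along the first light-like line. *)

(** * Limits in the hollow ball model *)

Section Limits.
Context {R : realType} {T : Type} {F : set_system T} {FF : Filter F}.
Implicit Types f g u v x y : T -> R.

Lemma near_bounded_mul_cvg0 (K : R) f g :
  (\forall j \near F, `|f j| <= K) ->
  g j @[j --> F] --> 0 -> f j * g j @[j --> F] --> 0.
Proof.
move=> fK /cvgr0Pnorm_lt g0; apply/cvgr0Pnorm_lt => e e0.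
have K0 : 0 < `|K| + 1 by rewrite ltr_pwDr.
have eK : 0 < e / (`|K| + 1) by rewrite divr_gt0.
near=> j.
have fj : `|f j| < `|K| + 1.
  rewrite (@le_lt_trans _ _ `|K|) ?ltrDl // (le_trans _ (ler_norm _)) //.
  by near: j.
have gj : `|g j| < e / (`|K| + 1) by near: j; exact: g0.
rewrite normrM (@le_lt_trans _ _ ((`|K| + 1) * `|g j|)) //.
  by rewrite ler_wpM2r // ltW.
by rewrite mulrC -ltr_pdivlMr.
Unshelve. all: by end_near. Qed.

Lemma norm_cvgy_inv0 u : `|u j| @[j --> F] --> +oo -> (u j)^-1 @[j --> F] --> 0.
Proof.
move=> /cvgryPgt uoo; apply/cvgr0Pnorm_lt => e e0; near=> j.
have uj : e^-1 < `|u j| by near: j.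
by rewrite normfV invf_plt // ?posrE // (lt_trans _ uj) ?invr_gt0.
Unshelve. all: by end_near. Qed.

Lemma cvgy_norm_cvgy u : u j @[j --> F] --> +oo -> `|u j| @[j --> F] --> +oo.
Proof. by apply: ger_cvgy; near=> j; exact: ler_norm.
Unshelve. all: by end_near. Qed.

Lemma cvgNy_norm_cvgy u : u j @[j --> F] --> -oo -> `|u j| @[j --> F] --> +oo.
Proof.
move=> /cvgNry uoo; apply: ger_cvgy uoo; near=> j.
by rewrite -normrN; exact: ler_norm.
Unshelve. all: by end_near. Qed.

(** The pair (u, v) stands for (P, M) when s = 1 and for (M, P) when s = -1, and
    e is the sign of u.  Dividing by u, the denominator of the projection tends
    to (1 + e sqrt 2) / 2 and the numerator of the last coordinate to s / 2; the
    quotient s / (1 + e sqrt 2) is s (e sqrt 2 - 1) because e^2 = 1. *)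
Lemma hollow_ball_cvg_null (e s : R) u v x y : e ^+ 2 = 1 ->
  (\forall j \near F, `|u j| = e * u j) ->
  `|u j| @[j --> F] --> +oo ->
  v j / u j @[j --> F] --> 0 ->
  x j / u j @[j --> F] --> 0 -> y j / u j @[j --> F] --> 0 ->
  hollow_ball ((u j + v j) / 2, x j, y j, s * (u j - v j) / 2) @[j --> F]
    --> ((0, 0, s * (e * Num.sqrt 2 - 1)) : R * R * R).
Proof.
move=> e1 ue uoo v0 x0 y0.
have uV := norm_cvgy_inv0 uoo.
(* The denominator t + sqrt (2 t^2 + 1) is u times d. *)
pose d j := (1 + v j / u j) / 2 +
  e * Num.sqrt (2 * ((1 + v j / u j) / 2) ^+ 2 + (u j)^-1 ^+ 2).
have s2 : (Num.sqrt 2) ^+ 2 = 2 :> R by rewrite sqr_sqrtr.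
have dl : d j @[j --> F] --> (1 + e * Num.sqrt 2) / 2.
  have -> : (1 + e * Num.sqrt 2) / 2 = (1 + 0) / 2 +
      e * Num.sqrt (2 * ((1 + 0) / 2) ^+ 2 + 0 ^+ 2).
    have -> : 2 * ((1 + 0) / 2) ^+ 2 + 0 ^+ 2 = (Num.sqrt 2 / 2) ^+ 2 :> R.
      by rewrite [RHS]expr_div_n s2; field.
    by rewrite sqrtr_sqr ger0_norm ?divr_ge0 ?sqrtr_ge0 //; field.
  have tl : (1 + v j / u j) / 2 @[j --> F] --> ((1 + 0) / 2 : R).
    by apply: cvgMl; apply: cvgD => //; exact: cvg_cst.
  apply: cvgD => //; apply: cvgMr.
  apply: (continuous_cvg _ (@sqrt_continuous R _)).
  apply: cvgD; last exact: (continuous_cvg _ (@exprn_continuous R 2 _)).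
  by apply: cvgMr; exact: (continuous_cvg _ (@exprn_continuous R 2 _)).
have dn0 : (1 + e * Num.sqrt 2) / 2 != 0.
  apply/eqP => h; have : (1 + e * Num.sqrt 2) * (1 - e * Num.sqrt 2) = -1.
    by transitivity (1 - e ^+ 2 * Num.sqrt 2 ^+ 2); [ring|rewrite e1 s2; ring].
  have -> : 1 + e * Num.sqrt 2 = 0 by lra.
  by rewrite mul0r => /eqP; rewrite eq_sym oppr_eq0 oner_eq0.
have dV : (d j)^-1 @[j --> F] --> ((1 + e * Num.sqrt 2) / 2)^-1 by exact: cvgV.
have lim_s : s * (e * Num.sqrt 2 - 1) = s * (1 - 0) / 2 * ((1 + e * Num.sqrt 2) / 2)^-1.
  apply/eqP; rewrite -(can2_eq (mulfK _) (mulfVK _)) //; apply/eqP.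
  transitivity (s / 2 * ((e ^+ 2) * (Num.sqrt 2 ^+ 2) - 1)); first by field.
  by rewrite e1 s2; field.
have zl : s * (1 - v j / u j) / 2 * (d j)^-1 @[j --> F] --> s * (e * Num.sqrt 2 - 1).
  rewrite lim_s; apply: cvgM => //; apply: cvgMl; apply: cvgMr.
  by apply: cvgB => //; exact: cvg_cst.
have xl w : w j / u j @[j --> F] --> 0 -> w j / u j * (d j)^-1 @[j --> F] --> 0.
  move=> w0; rewrite -[X in _ --> X](mul0r ((1 + e * Num.sqrt 2) / 2)^-1).
  exact: cvgM.
have : (x j / u j * (d j)^-1, y j / u j * (d j)^-1,
    s * (1 - v j / u j) / 2 * (d j)^-1) @[j --> F]
    --> ((0, 0, s * (e * Num.sqrt 2 - 1)) : R * R * R).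
  exact: (cvg_pair (cvg_pair (xl _ x0) (xl _ y0)) zl).
apply: cvg_trans; apply: near_eq_cvg; near=> j.
have u0 : u j != 0.
  by rewrite -normr_gt0; near: j; exact: cvgry_gt.
have -> : hollow_ball ((u j + v j) / 2, x j, y j, s * (u j - v j) / 2) =
  (x j / (u j * d j), y j / (u j * d j), s * (u j - v j) / 2 / (u j * d j)).
  rewrite /hollow_ball.
  suff -> : (u j + v j) / 2 + Num.sqrt (2 * ((u j + v j) / 2) ^+ 2 + 1) =
    u j * d j by [].
  rewrite /d mulrDr [u j * (e * _)]mulrA [u j * e]mulrC.
  rewrite -(_ : `|u j| = e * u j); last by near: j.
  rewrite -(sqrtr_sqr (u j)) -sqrtrM ?sqr_ge0 //.
  by congr (_ + Num.sqrt _); field.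
rewrite !invfM !mulrA; congr (_, _, _).
by congr (_ * _); field.
Unshelve. all: by end_near. Qed.

End Limits.

(** * Size of the components of the catenoid *)

Section CatenoidEstimates.
Context {R : realType} (m : nat).
Hypothesis hm : (2 <= m)%N.
Implicit Types r th K : R.

Let c : R := (m%:R ^+ 2 - 1) / (4 * m%:R).
Let q : R := (m%:R - 1) / (m%:R + 1).
Let q' : R := (m%:R + 1) / (m%:R - 1).
Let g : R := (m%:R - 1) ^+ 2 / (4 * m%:R) + (m%:R + 1) ^+ 2 / (4 * m%:R).

Let m1 : 1 < m%:R :> R. Proof. by rewrite ltr1n. Qed.
Let c0 : 0 < c.
Proof.
by have h := m1; rewrite divr_gt0 ?mulr_gt0 // ?subr_gt0 ?exprn_egt1 //; lra.
Qed.
Let q0 : 0 < q. Proof. by have h := m1; rewrite divr_gt0 //; lra. Qed.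
Let q'0 : 0 < q'. Proof. by have h := m1; rewrite divr_gt0 //; lra. Qed.

(** The quantity whose sign separates the domains A and B, before it is
    normalised by the sign of r; x0 - x3 is proportional to its quotient by r up
    to a term of order r^(m-1). *)
Definition axial_height r th : R := r ^+ m + 2 * cos (m%:R * th).

Lemma Re_x1_plus_ix2 r th : complex.Re (x1_plus_ix2 m r th) =
  complex.Re (gamma m th) - c * r ^+ m * cos th.
Proof. by rewrite /x1_plus_ix2 /expi /= -/c; ring. Qed.

Lemma Im_x1_plus_ix2 r th : complex.Im (x1_plus_ix2 m r th) =
  complex.Im (gamma m th) - c * r ^+ m * sin th.
Proof. by rewrite /x1_plus_ix2 /expi /= -/c; ring. Qed.

Let wave_le (a b x y : R) : 0 <= a -> 0 <= b -> `|x| <= 1 -> `|y| <= 1 ->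
  `|a * x + b * y| <= a + b.
Proof.
move=> a0 b0 x1 y1; rewrite (le_trans (ler_normD _ _)) // !normrM.
by rewrite !(@ger0_norm _ a, @ger0_norm _ b) // lerD // ler_piMr.
Qed.

Lemma gamma_bounded th :
  `|complex.Re (gamma m th)| <= g /\ `|complex.Im (gamma m th)| <= g.
Proof.
have a0 : 0 <= (m%:R - 1) ^+ 2 / (4 * m%:R) :> R.
  by rewrite divr_ge0 ?sqr_ge0 ?mulr_ge0.
have b0 : 0 <= (m%:R + 1) ^+ 2 / (4 * m%:R) :> R.
  by rewrite divr_ge0 ?sqr_ge0 ?mulr_ge0.
rewrite /gamma /expi /= !(mul0r, subr0, addr0).
by split; apply: wave_le => //; rewrite ?cos_max ?sin_max.
Qed.

(** On bounded r the only part of the map that can be large is c h / r: the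
    remainder of x0 - x3 is - c (1 + q') r^(m-1), which has no pole because m is
    positive. *)
Lemma catenoid_bounded K : exists B, forall r th, `|r| <= K ->
  [/\ `|x0_plus_x3 m r th| <= B,
      `|complex.Re (x1_plus_ix2 m r th)| <= B,
      `|complex.Im (x1_plus_ix2 m r th)| <= B &
      r != 0 ->
      `|x0_minus_x3 m r th - c * (axial_height r th / r)| <= B].
Proof.
pose B1 := c * K * (2 + q * K ^+ m); pose B2 := g + c * K ^+ m.
pose B3 := c * (1 + q') * K ^+ m.-1.
exists (Num.max B1 (Num.max B2 B3)) => r th rK.
have rXK n : `|r ^+ n| <= K ^+ n by rewrite normrX lerXn2r ?nnegrE // (le_trans _ rK).
have cr : `|c * r ^+ m| <= c * K ^+ m by rewrite normrM gtr0_norm // ler_wpM2l // ltW.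
have [gRe gIm] := gamma_bounded th.
have planar (w t : R) : `|w| <= g -> `|t| <= 1 -> `|w - c * r ^+ m * t| <= B2.
  move=> wg t1; rewrite (le_trans (ler_normB _ _)) // lerD // normrM.
  by rewrite (le_trans _ cr) // ler_piMr.
rewrite !le_max Re_x1_plus_ix2 Im_x1_plus_ix2; split.
- apply/orP; left; rewrite /x0_plus_x3 -/c -/q normrM ler_pM //.
    by rewrite normrM gtr0_norm // ler_wpM2l // ltW.
  rewrite (le_trans (ler_normB _ _)) // lerD //.
    by rewrite normrM normr_nat ler_piMr // cos_max.
  by rewrite normrM gtr0_norm // ler_wpM2l // ltW.
- by rewrite planar ?cos_max ?orbT.
- by rewrite planar ?sin_max ?orbT.
move=> r0; have -> : x0_minus_x3 m r th - c * (axial_height r th / r) =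
    - (c * (1 + q') * r ^+ m.-1).
  rewrite /x0_minus_x3 -/c -/q' /axial_height.
  have -> : r ^+ m = r * r ^+ m.-1 by rewrite -exprS prednK // ltnW.
  by field.
have cq0 : 0 < c * (1 + q') by rewrite mulr_gt0 // addr_gt0.
apply/orP; right; apply/orP; right.
by rewrite normrN normrM gtr0_norm // ler_wpM2l // ltW.
Qed.

Lemma norm_catenoid_map_le r th : `|catenoid_map m (r, th)| <=
  `|x0_plus_x3 m r th| + `|x0_minus_x3 m r th| +
  `|complex.Re (x1_plus_ix2 m r th)| + `|complex.Im (x1_plus_ix2 m r th)|.
Proof.
rewrite /catenoid_map.
move: (x0_plus_x3 _ _ _) (x0_minus_x3 _ _ _) (complex.Re _) (complex.Im _) => P M x y.
rewrite !prod_normE /=.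
have P0 := normr_ge0 P; have M0 := normr_ge0 M.
have x0 := normr_ge0 x; have y0 := normr_ge0 y.
have h2 (z : R) : `|z / 2| = `|z| / 2 by rewrite normrM normfV normr_nat.
have := ler_normD P M; have := ler_normB P M.
rewrite !ge_max !h2 => D1 D2.
by apply/andP; split; [apply/andP; split; [apply/andP; split|]|]; lra.
Qed.

Lemma signed_height_pos r th : 0 < r ->
  signed_height m (r, th) = axial_height r th.
Proof. by move=> r0; rewrite /signed_height /= gtr0_sg // expr1n mul1r. Qed.

Lemma signed_height_neg r th : r < 0 ->
  signed_height m (r, th) = (-1) ^+ odd m * axial_height r th.
Proof. by move=> r0; rewrite /signed_height /= ltr0_sg // signr_odd. Qed.

(** * Asymptotics of the projected catenoid *)

Section CatenoidLimits.
Context {T : Type} {F : set_system T} {FF : Filter F} (zeta : T -> R * R).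

Let r j := (zeta j).1.
Let P j := x0_plus_x3 m (zeta j).1 (zeta j).2.
Let M j := x0_minus_x3 m (zeta j).1 (zeta j).2.
Let X j := complex.Re (x1_plus_ix2 m (zeta j).1 (zeta j).2).
Let Y j := complex.Im (x1_plus_ix2 m (zeta j).1 (zeta j).2).

Let catenoidE j :
  catenoid_map m (zeta j) = ((P j + M j) / 2, X j, Y j, (P j - M j) / 2).
Proof. by rewrite /P /M /X /Y; case: (zeta j). Qed.

(** After division by r^(m+1), the component P = x0 + x3 tends to - c q < 0 and
    the other components tend to 0.  So P dominates, and its sign e is opposite
    to that of r^(m+1). *)
Lemma hollow_ball_catenoid_cvg_large (e : R) : e ^+ 2 = 1 ->
  `|(zeta j).1| @[j --> F] --> +oo ->
  (\forall j \near F, e * (zeta j).1 ^+ m.+1 < 0) ->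
  hollow_ball (catenoid_map m (zeta j)) @[j --> F]
    --> ((0, 0, e * Num.sqrt 2 - 1) : R * R * R).
Proof.
move=> e1 roo er; pose w j := (r j)^-1.
have w0 : w j @[j --> F] --> 0 by exact: norm_cvgy_inv0.
have wX k : (0 < k)%N -> w j ^+ k @[j --> F] --> 0.
  move=> k0; have zX : 0 = 0 ^+ k :> R by rewrite expr0n gtn_eqF.
  by rewrite [X in _ --> X]zX; exact: (continuous_cvg _ (@exprn_continuous R k _)).
have bX (f : T -> R) K k : (forall j, `|f j| <= K) -> (0 < k)%N ->
    f j * w j ^+ k @[j --> F] --> 0.
  by move=> fK k0; apply: (@near_bounded_mul_cvg0 _ _ _ _ K); [exact: nearW|exact: wX].
have m0 : (0 < m)%N by exact: ltnW.
pose C j := cos (m%:R * (zeta j).2).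
have CX : C j * w j ^+ m @[j --> F] --> 0.
  by apply: (bX C 1 m _ m0) => j; exact: cos_max.
pose p j := c * (2 * (C j * w j ^+ m) - q).
have pl : p j @[j --> F] --> - (c * q).
  rewrite (_ : - (c * q) = c * (2 * 0 - q)); last by ring.
  by apply: cvgMr; apply: cvgB; [apply: cvgMr; exact: CX|exact: cvg_cst].
have cq0 : 0 < c * q by rewrite mulr_gt0.
have r_neq0 : \forall j \near F, r j != 0.
  by near=> j; rewrite -normr_gt0; near: j; exact: cvgry_gt.
have PE j : r j != 0 -> P j = r j ^+ m.+1 * p j.
  move=> rj; rewrite /P /x0_plus_x3 -/c -/q -/(r j) -/(C j) /p /w exprVn exprS.
  by field; rewrite expf_neq0.
(* Half of the limit: p is then negative and bounded away from 0. *)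
have p_lt : \forall j \near F, p j < - (c * q / 2).
  by apply: (cvgr_lt _ pl); lra.
have quot0 (a b : T -> R) : (\forall j \near F, a j = r j ^+ m.+1 * b j) ->
    b j @[j --> F] --> 0 -> a j / P j @[j --> F] --> 0.
  move=> ab b0; have : b j * (p j)^-1 @[j --> F] --> 0.
    rewrite -[X in _ --> X](mul0r (- (c * q))^-1); apply: cvgM => //; apply: cvgV => //.
    by rewrite oppr_eq0 gt_eqF.
  apply: cvg_trans; apply: near_eq_cvg; near=> j.
  have rj : r j != 0 by near: j.
  have -> : a j = r j ^+ m.+1 * b j by near: j.
  by rewrite PE // -[RHS]mulf_div mulfV ?mul1r // expf_neq0.
have planar (gam tr : T -> R) : (forall j, `|gam j| <= g) -> (forall j, `|tr j| <= 1) ->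
    (gam j - c * r j ^+ m * tr j) / P j @[j --> F] --> 0.
  move=> gb tb.
  apply: (quot0 _ (fun j => gam j * w j ^+ m.+1 - c * (tr j * w j ^+ 1))).
    near=> j; have rj : r j != 0 by near: j.
    rewrite /w exprVn expr1 exprS; field; by rewrite rj expf_neq0.
  rewrite (_ : 0 = 0 - c * 0); last by ring.
  by apply: cvgB; [exact: (bX gam g)|apply: cvgMr; exact: (bX tr 1)].
under eq_fun do rewrite catenoidE -[P _ - M _]mul1r.
rewrite -[X in (0, 0, X)]mul1r; apply: hollow_ball_cvg_null => //.
- near=> j.
  have rj : r j != 0 by near: j.
  have en : `|e| = 1 by apply/eqP; rewrite -sqrp_eq1 // real_normK ?num_real // e1.
  rewrite -[LHS]mul1r -en -normrM ger0_norm // PE // mulrA.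
  have erj : e * r j ^+ m.+1 < 0 by near: j.
  have pj : p j < - (c * q / 2) by near: j.
  by rewrite mulr_le0 // ltW // (lt_trans pj) // oppr_lt0 divr_gt0.
- have cq2 : 0 < c * q / 2 by rewrite divr_gt0.
  apply/cvgryPge => A; near=> j; have rj : r j != 0 by near: j.
  have Ar : A / (c * q / 2) <= `|r j| by near: j; exact: cvgry_ge.
  rewrite (@le_trans _ _ (c * q / 2 * `|r j|)) //.
    by rewrite mulrC -ler_pdivrMr.
  rewrite PE // normrM mulrC; apply: ler_pM => //; first exact: ltW.
    by rewrite normrX exprS ler_peMr // exprn_ege1 //; near: j; exact: cvgry_ge.
  have : p j < - (c * q / 2) by near: j.
  by move=> pj; rewrite ltr0_norm; lra.
- apply: (quot0 _ (fun j => w j ^+ 2 * (c * (2 * (C j * w j ^+ m) - q')))).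
    near=> j; have rj : r j != 0 by near: j.
    rewrite /M /x0_minus_x3 -/c -/q' -/(r j) -/(C j) /w !exprVn exprS.
    by field; rewrite rj expf_neq0.
  rewrite (_ : 0 = 0 * (c * (2 * 0 - q'))); last by ring.
  apply: cvgM; first exact: wX.
  by apply: cvgMr; apply: cvgB; [apply: cvgMr; exact: CX|exact: cvg_cst].
- rewrite /X; under eq_fun do rewrite Re_x1_plus_ix2.
  by apply: planar => j; [exact: (gamma_bounded _).1|exact: cos_max].
- rewrite /Y; under eq_fun do rewrite Im_x1_plus_ix2.
  by apply: planar => j; [exact: (gamma_bounded _).2|exact: sin_max].
Unshelve. all: by end_near. Qed.

(** Here P, x1 and x2 are bounded, so M = x0 - x3 carries the divergence.  As M
    differs from c h / r by a bounded amount, M has the sign e of h / r as soon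
    as |M| exceeds that bound. *)
Lemma hollow_ball_catenoid_cvg_small (e K : R) : e ^+ 2 = 1 ->
  (\forall j \near F, `|(zeta j).1| <= K) ->
  (\forall j \near F, 0 < e * (axial_height (zeta j).1 (zeta j).2 / (zeta j).1)) ->
  `|catenoid_map m (zeta j)| @[j --> F] --> +oo ->
  hollow_ball (catenoid_map m (zeta j)) @[j --> F]
    --> ((0, 0, - (e * Num.sqrt 2 - 1)) : R * R * R).
Proof.
move=> e1 rK eh foo; have [B Bb] := catenoid_bounded K.
have en : `|e| = 1 by apply/eqP; rewrite -sqrp_eq1 // real_normK ?num_real // e1.
have bnd : \forall j \near F, [/\ `|P j| <= B, `|X j| <= B & `|Y j| <= B].
  by near=> j; have [|? ? ? _] := Bb (zeta j).1 (zeta j).2; [near: j|split].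
have Moo : `|M j| @[j --> F] --> +oo.
  apply/cvgryPge => A; near=> j.
  have foA : A + 3 * B <= `|catenoid_map m (zeta j)| by near: j; exact: cvgry_ge.
  have [PB XB YB] : [/\ `|P j| <= B, `|X j| <= B & `|Y j| <= B] by near: j.
  have := norm_catenoid_map_le (zeta j).1 (zeta j).2.
  rewrite -surjective_pairing -/(P j) -/(M j) -/(X j) -/(Y j); lra.
have eM : \forall j \near F, `|M j| = e * M j.
  near=> j.
  have hj : 0 < e * (axial_height (zeta j).1 (zeta j).2 / (zeta j).1) by near: j.
  have rj : (zeta j).1 != 0.
    by apply: contraTN hj => /eqP ->; rewrite invr0 !mulr0 ltxx.
  have Mj : B < `|M j| by near: j; exact: cvgry_gt.
  have [|_ _ _ /(_ rj)] := Bb (zeta j).1 (zeta j).2; first by near: j.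
  rewrite -/(M j) -[X in X <= _]mul1r -en -normrM mulrBr => MB.
  have ch : 0 < c * (e * (axial_height (zeta j).1 (zeta j).2 / (zeta j).1)).
    by rewrite mulr_gt0.
  rewrite [e * (c * _)]mulrCA in MB; move: MB ch; set h := c * _.
  rewrite ler_norml => /andP[MB _] h0.
  move: Mj; rewrite -[`|M j|]mul1r -en -normrM; case: (ger0P (e * M j)) => // eM0; lra.
have quot0 (a : T -> R) : (\forall j \near F, `|a j| <= B) ->
    a j / M j @[j --> F] --> 0.
  by move=> aB; apply: (near_bounded_mul_cvg0 aB); exact: norm_cvgy_inv0.
have -> : (fun j => hollow_ball (catenoid_map m (zeta j))) =
    (fun j => hollow_ball ((M j + P j) / 2, X j, Y j, (-1) * (M j - P j) / 2)).
  by apply/funext => j; rewrite catenoidE [M j + _]addrC mulN1r opprB.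
rewrite -[- (_ - _)]mulN1r; apply: hollow_ball_cvg_null => //.
- by apply: quot0; apply: filterS bnd => j [].
- by apply: quot0; apply: filterS bnd => j [].
- by apply: quot0; apply: filterS bnd => j [].
Unshelve. all: by end_near. Qed.

(** An ultrafilter chooses between each set and its complement.  Once r is
    bounded, every remaining alternative, |r| bounded below or h = 0, makes
    h / r bounded and hence contradicts the divergence of the map. *)
Lemma ultra_catenoid_trichotomy : UltraFilter F ->
  (\forall j \near F, Omega (zeta j)) ->
  `|catenoid_map m (zeta j)| @[j --> F] --> +oo ->
  [\/ (zeta j).1 @[j --> F] --> +oo,
      (zeta j).1 @[j --> F] --> -oo |
      (zeta j).1 @[j --> F] --> (0 : R) /\
      [\/ \forall j \near F, A_pos m (zeta j),
          \forall j \near F, A_neg m (zeta j),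
          \forall j \near F, B_pos m (zeta j) |
          \forall j \near F, B_neg m (zeta j)]].
Proof.
move=> UF Om foo.
have PF := @ultra_proper _ _ UF.
have dec (Q : set T) : F Q \/ F (~` Q) by exact: in_ultra_setVsetC.
have [roo|] := pselect (forall A : R, \forall j \near F, A < r j).
  by apply: Or31; apply/cvgryPgt.
move=> /existsNP[A1 rA1].
have [roo|] := pselect (forall A : R, \forall j \near F, r j < A).
  by apply: Or32; apply/cvgrNyPlt.
move=> /existsNP[A2 rA2]; apply: Or33.
have [K rK] : exists K, \forall j \near F, `|r j| <= K.
  exists (`|A1| + `|A2|).
  have [//|n1] := dec [set j | A1 < r j]; have [//|n2] := dec [set j | r j < A2].
  apply: filterS2 n1 n2 => j /= /negP; rewrite -leNgt => j1 /negP; rewrite -leNgt => j2.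
  have := ler_norm A1; have := ler_norm (- A2); rewrite normrN => h2 h1.
  have := normr_ge0 A1; have := normr_ge0 A2 => p2 p1.
  by rewrite ler_norml; apply/andP; split; lra.
have [B Bb] := catenoid_bounded K.
have no_bound (D : R) :
    (\forall j \near F, `|axial_height (zeta j).1 (zeta j).2 / r j| <= D) -> False.
  move=> hD; near F => j.
  have Oj : Omega (zeta j) by near: j.
  have rj : r j != 0.
    by case: Oj => /= h; [rewrite gt_eqF | rewrite lt_eqF].
  have hj : `|axial_height (zeta j).1 (zeta j).2 / r j| <= D by near: j.
  have fj : 4 * B + c * D < `|catenoid_map m (zeta j)| by near: j; exact: cvgry_gt.
  have [|PB XB YB /(_ rj)] := Bb (zeta j).1 (zeta j).2; first by near: j.
  rewrite -/(P j) in PB; rewrite -/(X j) in XB; rewrite -/(Y j) in YB.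
  rewrite -/(M j) -/(r j) => MB.
  have chD : `|c * (axial_height (zeta j).1 (zeta j).2 / r j)| <= c * D.
    by rewrite normrM gtr0_norm // ler_wpM2l // ltW.
  have := norm_catenoid_map_le (zeta j).1 (zeta j).2.
  rewrite -surjective_pairing -/(P j) -/(M j) -/(X j) -/(Y j).
  have := ler_normD (M j - c * (axial_height (zeta j).1 (zeta j).2 / r j))
    (c * (axial_height (zeta j).1 (zeta j).2 / r j)).
  rewrite subrK; lra.
have r0 : r j @[j --> F] --> 0.
  apply/cvgr0Pnorm_lt => eps eps0; have [//|rN] := dec [set j | `|r j| < eps].
  exfalso; apply: (no_bound ((K ^+ m + 2) / eps)); near=> j.
  have rKj : `|r j| <= K by near: j; exact: rK.
  have rej : eps <= `|r j| by rewrite leNgt; apply/negP; near: j; exact: rN.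
  rewrite normrM normfV ler_pM ?invr_ge0 //; last first.
    by rewrite lef_pV2 ?posrE // (lt_le_trans eps0).
  rewrite (le_trans (ler_normD _ _)) // lerD //.
    by rewrite normrX lerXn2r ?nnegrE // (le_trans _ rKj).
  by rewrite normrM normr_nat ler_piMr // cos_max.
split=> //.
have sgn_cases : (\forall j \near F, 0 < signed_height m (zeta j)) \/
    (\forall j \near F, signed_height m (zeta j) < 0).
  have [|hnp] := dec [set j | 0 < signed_height m (zeta j)]; first by left.
  have [|hnn] := dec [set j | signed_height m (zeta j) < 0]; first by right.
  exfalso; apply: (no_bound 0); near=> j.
  have Oj : Omega (zeta j) by near: j.
  have : signed_height m (zeta j) == 0.
    rewrite eq_le leNgt [X in _ && X]leNgt.
    by apply/andP; split; apply/negP; near: j.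
  rewrite /signed_height mulf_eq0 expf_eq0 sgr_eq0 -/(r j).
  have /negPf -> : r j != 0.
    by case: Oj => /= h; [rewrite gt_eqF | rewrite lt_eqF].
  by rewrite andbF /= => /eqP h0; rewrite /axial_height h0 mul0r normr0.
have [rp|rN] := dec [set j | 0 < r j].
  case: sgn_cases => h; [apply: Or41|apply: Or43]; exact: filterI rp h.
have rn : \forall j \near F, r j < 0.
  by apply: filterS2 Om rN => j [].
case: sgn_cases => h; [apply: Or42|apply: Or44]; exact: filterI rn h.
Unshelve. all: by end_near. Qed.

End CatenoidLimits.

End CatenoidEstimates.

Section IdealLimits.
Context {R : realType} (m : nat).
Hypothesis hm : (2 <= m)%N.

Section Filters.
Context {T : Type} {F : set_system T} {FF : Filter F} (zeta : T -> R * R).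

Lemma hollow_ball_catenoid_cvgy : (zeta j).1 @[j --> F] --> +oo ->
  hollow_ball (catenoid_map m (zeta j)) @[j --> F] --> n_minus R.
Proof.
move=> roo; have -> : n_minus R = (0, 0, (-1) * Num.sqrt 2 - 1).
  by rewrite /n_minus; congr (_, _); ring.
apply: hollow_ball_catenoid_cvg_large => //; first by rewrite sqrrN expr1n.
  exact: cvgy_norm_cvgy.
near=> j; rewrite mulN1r oppr_lt0 exprn_gt0 //; near: j; exact: cvgry_gt.
Unshelve. all: by end_near. Qed.

Lemma hollow_ball_catenoid_cvgNy : (zeta j).1 @[j --> F] --> -oo ->
  hollow_ball (catenoid_map m (zeta j)) @[j --> F] -->
    if odd m then n_minus R else p_plus R.
Proof.
move=> roo; have -> : (if odd m then n_minus R else p_plus R) =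
    (0, 0, (-1) ^+ odd m * Num.sqrt 2 - 1).
  by case: (odd m); rewrite /n_minus /p_plus; congr (_, _); ring.
apply: hollow_ball_catenoid_cvg_large => //; first exact: sqrr_sign.
  exact: cvgNy_norm_cvgy.
near=> j; have rj : (zeta j).1 < 0 by near: j; exact: cvgrNy_lt.
(* (-1)^m r^(m+1) = r (- r)^m, and - r is positive. *)
by rewrite signr_odd exprS mulrCA -exprMn mulN1r nmulr_rlt0 // exprn_gt0 // oppr_gt0.
Unshelve. all: by end_near. Qed.

Let cvg_small (b : bool) :
  (zeta j).1 @[j --> F] --> 0 ->
  `|catenoid_map m (zeta j)| @[j --> F] --> +oo ->
  (\forall j \near F,
    0 < (-1) ^+ b * (axial_height m (zeta j).1 (zeta j).2 / (zeta j).1)) ->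
  hollow_ball (catenoid_map m (zeta j)) @[j --> F] -->
    if b then n_plus R else p_minus R.
Proof.
move=> r0 foo hb; have -> : (if b then n_plus R else p_minus R) =
    (0, 0, - ((-1) ^+ b * Num.sqrt 2 - 1)).
  by case: b {hb}; rewrite /n_plus /p_minus; congr (_, _); ring.
apply: (@hollow_ball_catenoid_cvg_small _ _ hm _ _ _ _ _ 1) => //.
  exact: sqrr_sign.
by apply: cvgr_norm_le r0 _ _; rewrite normr0.
Qed.

(** The sign of M is that of h / r.  For r > 0 this is the sign that defines the
    domains; for r < 0 the domains are defined by the sign of (-1)^m h, so the
    two differ by the factor - (-1)^m. *)
Lemma hollow_ball_catenoid_cvg0 :
  (zeta j).1 @[j --> F] --> 0 ->
  `|catenoid_map m (zeta j)| @[j --> F] --> +oo ->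
  [/\ (\forall j \near F, A_pos m (zeta j)) ->
        hollow_ball (catenoid_map m (zeta j)) @[j --> F] --> p_minus R,
      (\forall j \near F, A_neg m (zeta j)) ->
        hollow_ball (catenoid_map m (zeta j)) @[j --> F] -->
          (if odd m then p_minus R else n_plus R),
      (\forall j \near F, B_pos m (zeta j)) ->
        hollow_ball (catenoid_map m (zeta j)) @[j --> F] --> n_plus R &
      (\forall j \near F, B_neg m (zeta j)) ->
        hollow_ball (catenoid_map m (zeta j)) @[j --> F] -->
          (if odd m then n_plus R else p_minus R)].
Proof.
move=> r0 foo; split.
- move=> dom; apply: (@cvg_small false) => //; apply: filterS dom => j.
  case: (zeta j) => r th [/= rj]; rewrite signed_height_pos // => h.
  by rewrite expr0 mul1r divr_gt0.
- rewrite -(if_neg (odd m) (n_plus R)) => dom; apply: cvg_small => //.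
  apply: filterS dom => j.
  case: (zeta j) => r th [/= rj]; rewrite signed_height_neg // => h.
  by rewrite signrN mulrA nmulr_lgt0 ?invr_lt0 // mulNr oppr_lt0.
- move=> dom; apply: (@cvg_small true) => //; apply: filterS dom => j.
  case: (zeta j) => r th [/= rj]; rewrite signed_height_pos // => h.
  by rewrite expr1 mulN1r oppr_gt0 pmulr_llt0 ?invr_gt0.
- move=> dom; apply: cvg_small => //; apply: filterS dom => j.
  case: (zeta j) => r th [/= rj]; rewrite signed_height_neg // => h.
  by rewrite mulrA nmulr_rgt0 ?invr_lt0.
Qed.

(** On a line (t, x, y, -t) the coordinate x0 + x3 vanishes, so u = 2 t and
    v = 0 are the dominating and the dominated null coordinate. *)
Lemma null_line_hollow_ball_cvg (b : bool) (t x y : T -> R) :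
  (\forall j \near F, `|t j| = (-1) ^+ b * t j) ->
  `|t j| @[j --> F] --> +oo ->
  (\forall j \near F, `|x j| <= 1) -> (\forall j \near F, `|y j| <= 1) ->
  hollow_ball (t j, x j, y j, - t j) @[j --> F] --> if b then n_plus R else p_minus R.
Proof.
move=> tb too xb yb; have -> : (if b then n_plus R else p_minus R) =
    (0, 0, (-1) * ((-1) ^+ b * Num.sqrt 2 - 1)).
  by case: b {tb}; rewrite /n_plus /p_minus; congr (_, _); ring.
have -> : (fun j => hollow_ball (t j, x j, y j, - t j)) =
    (fun j => hollow_ball ((2 * t j + 0) / 2, x j, y j, (-1) * (2 * t j - 0) / 2)).
  by apply/funext => j; congr (hollow_ball (_, _, _, _)); field.
have t2oo : `|2 * t j| @[j --> F] --> +oo.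
  apply: ger_cvgy too; near=> j; rewrite normrM normr_nat.
  by have := normr_ge0 (t j); lra.
have quot0 (a : T -> R) : (\forall j \near F, `|a j| <= 1) ->
    a j / (2 * t j) @[j --> F] --> 0.
  by move=> ab; apply: (near_bounded_mul_cvg0 ab); exact: norm_cvgy_inv0.
apply: hollow_ball_cvg_null => //; first exact: sqrr_sign.
- by near=> j; rewrite normrM normr_nat mulrCA; congr (_ * _); near: j.
- by apply: (quot0 (fun=> 0)); near=> j; rewrite normr0.
- exact: quot0.
- exact: quot0.
Unshelve. all: by end_near. Qed.

End Filters.

End IdealLimits.

(** * Projections that approach the ideal boundaries *)

Section DeSitterBoundary.
Context {R : realType}.
Implicit Types X : R * R * R * R.

Definition sqnorm3 (xi : R * R * R) : R := xi.1.1 ^+ 2 + xi.1.2 ^+ 2 + xi.2 ^+ 2.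

Lemma norm3_sqr (xi : R * R * R) : norm3 xi ^+ 2 = sqnorm3 xi.
Proof.
by case: xi => -[x y] z; rewrite /norm3 sqr_sqrtr // !addr_ge0 // sqr_ge0.
Qed.

(** With w = t / sqrt (2 t^2 + 1), a point of de Sitter space projects to a
    point of squared norm n = (1 - w) / (1 + w); the gap is 1 - 2 w^2 written in
    terms of n. *)
Definition boundary_gap (n : R) : R := 1 - 2 * ((1 - n) / (1 + n)) ^+ 2.

Lemma hollow_ball_gap X : deSitter X ->
  boundary_gap (sqnorm3 (hollow_ball X)) = (2 * X.1.1.1 ^+ 2 + 1)^-1.
Proof.
case: X => -[[t x] y] z; rewrite /deSitter /lorentz /= => dS.
rewrite /sqnorm3 /boundary_gap /=.
have t2 : 0 < 2 * t ^+ 2 + 1 by rewrite ltr_wpDl // mulr_ge0 // sqr_ge0.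
set s := Num.sqrt _; have s0 : 0 < s by rewrite sqrtr_gt0.
have s2 : s ^+ 2 = 2 * t ^+ 2 + 1 by rewrite sqr_sqrtr // ltW.
have ts : 0 < t + s.
  have : `|t| < s by rewrite -sqrtr_sqr ltr_sqrt //; have := sqr_ge0 t; lra.
  by have := ler_norm (- t); rewrite normrN; lra.
have ts0 : t + s != 0 by rewrite gt_eqF.
have st0 : s + t != 0 by rewrite addrC.
have -> : (x / (t + s)) ^+ 2 + (y / (t + s)) ^+ 2 + (z / (t + s)) ^+ 2 =
    (s - t) / (s + t).
  rewrite !expr_div_n -!mulrDl; apply/eqP; rewrite eqr_div ?expf_neq0 ?st0 //.
  have -> : x ^+ 2 + y ^+ 2 + z ^+ 2 = s ^+ 2 - t ^+ 2 by rewrite s2; lra.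
  by apply/eqP; ring.
have -> : (1 - (s - t) / (s + t)) / (1 + (s - t) / (s + t)) = t / s.
  by field; rewrite gt_eqF //=; lra.
rewrite expr_div_n s2.
by field; rewrite gt_eqF.
Qed.

Lemma boundary_gap0 (xi : R * R * R) :
  ideal_boundary_pos xi \/ ideal_boundary_neg xi -> boundary_gap (sqnorm3 xi) = 0.
Proof.
have s2 : (Num.sqrt 2) ^+ 2 = 2 :> R by rewrite sqr_sqrtr.
have s0 : 0 < Num.sqrt 2 :> R by rewrite sqrtr_gt0.
have gap (e : R) : e ^+ 2 = 1 -> boundary_gap ((Num.sqrt 2 - e) ^+ 2) = 0.
  move=> e1; rewrite /boundary_gap.
  have -> : (1 - (Num.sqrt 2 - e) ^+ 2) / (1 + (Num.sqrt 2 - e) ^+ 2) = e / Num.sqrt 2.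
    have -> : 1 - (Num.sqrt 2 - e) ^+ 2 = e * (2 * (Num.sqrt 2 - e)).
      rewrite sqrrB s2 e1.
      have -> : e * (2 * (Num.sqrt 2 - e)) = 2 * e * Num.sqrt 2 - 2 * e ^+ 2 by ring.
      rewrite e1; ring.
    have -> : 1 + (Num.sqrt 2 - e) ^+ 2 = Num.sqrt 2 * (2 * (Num.sqrt 2 - e)).
      have -> : Num.sqrt 2 * (2 * (Num.sqrt 2 - e)) =
        2 * Num.sqrt 2 ^+ 2 - 2 * e * Num.sqrt 2 by ring.
      rewrite sqrrB s2 e1; ring.
    rewrite -mulf_div mulfV ?mulr1 // mulf_neq0 // subr_eq0.
    apply/eqP => se; move: e1; rewrite -se s2; lra.
  by rewrite expr_div_n e1 s2; field.
have gap_pos := gap 1 (expr1n _ 2).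
have := gap (- 1); rewrite opprK sqrrN expr1n => /(_ erefl) gap_neg.
by rewrite -norm3_sqr => -[->|->].
Qed.

(** The gap is continuous in the squared norm, vanishes on both ideal boundaries
    and equals 1 / (2 t^2 + 1) on projected points, so t^2 is forced to grow. *)
Lemma hollow_ball_cvg_boundary {T : Type} {F : set_system T} {FF : Filter F}
    (X : T -> R * R * R * R) (xi : R * R * R) :
  (\forall j \near F, deSitter (X j)) -> hollow_ball (X j) @[j --> F] --> xi ->
  ideal_boundary_pos xi \/ ideal_boundary_neg xi ->
  `|(X j).1.1.1| @[j --> F] --> +oo.
Proof.
move=> dS Xxi bxi.
have sq (f : T -> R) (l : R) : f j @[j --> F] --> l -> f j ^+ 2 @[j --> F] --> l ^+ 2.
  by move=> fl; exact: (continuous_cvg _ (@exprn_continuous R 2 _)).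
have cvg3 : sqnorm3 (hollow_ball (X j)) @[j --> F] --> sqnorm3 xi.
  have c1 : (hollow_ball (X j)).1 @[j --> F] --> xi.1.
    exact: (cvg_comp _ _ Xxi cvg_fst).
  apply: cvgD; [apply: cvgD|]; apply: sq.
  - exact: (cvg_comp _ _ c1 cvg_fst).
  - exact: (cvg_comp _ _ c1 cvg_snd).
  - exact: (cvg_comp _ _ Xxi cvg_snd).
have gap0 : boundary_gap (sqnorm3 (hollow_ball (X j))) @[j --> F] --> 0.
  rewrite -(boundary_gap0 bxi); apply: cvgB; first exact: cvg_cst.
  apply: cvgMr; apply: sq; apply: cvgM.
    by apply: cvgB => //; exact: cvg_cst.
  apply: cvgV; last by apply: cvgD => //; exact: cvg_cst.
  by rewrite -norm3_sqr gt_eqF // ltr_pwDl // sqr_ge0.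
apply/cvgryPgt => A.
have A0 : 0 < 2 * A ^+ 2 + 1 by rewrite ltr_wpDl // mulr_ge0 // sqr_ge0.
near=> j; have dSj : deSitter (X j) by near: j.
have t0 : 0 < 2 * (X j).1.1.1 ^+ 2 + 1 by rewrite ltr_wpDl // mulr_ge0 // sqr_ge0.
have : boundary_gap (sqnorm3 (hollow_ball (X j))) < (2 * A ^+ 2 + 1)^-1.
  by near: j; apply: (cvgr_lt _ gap0); rewrite invr_gt0.
rewrite hollow_ball_gap // ltf_pV2 ?posrE // ltrD2r ltr_pM2l // => At.
rewrite (le_lt_trans (ler_norm A)) // -!sqrtr_sqr ltr_sqrt //.
by rewrite (le_lt_trans (sqr_ge0 A)).
Unshelve. all: by end_near. Qed.

End DeSitterBoundary.

(** * Ultrafilters, closures and subsequences *)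

Section Ultrafilters.

Lemma closure_image_ultra {S : Type} {V : topologicalType} (f : S -> V) (A : set S) p :
  closure (f @` A) p ->
  exists U : set_system S, [/\ UltraFilter U, U A & f x @[x --> U] --> p].
Proof.
move=> cp; pose G := filter_from (nbhs p) (fun B => A `&` f @^-1` B).
have FG : Filter G.
  apply: filter_from_filter; first by exists setT; exact: filterT.
  move=> B C pB pC; exists (B `&` C); first exact: filterI.
  by move=> x [Ax [Bx Cx]].
have PG : ProperFilter G.
  by apply: filter_from_proper => B /cp[_ [[x Ax <-] Bx]]; exists x.
have [U [UU GU]] := ultraFilterLemma PG; exists U; split => //.
  by apply: GU; exists setT; [exact: filterT|move=> x []].
by move=> B pB; apply: GU; exists B => // x [].
Qed.

Lemma near_cvg_closure {S : Type} {V : topologicalType} {F : set_system S}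
    {PF : ProperFilter F} (f : S -> V) (A : set V) p :
  (\forall x \near F, A (f x)) -> f x @[x --> F] --> p -> closure A p.
Proof.
move=> fA fp B /fp fB; have [x []] := filter_ex (filterI fA fB).
by exists (f x).
Qed.

(** Unboundedness makes the sets {j | K < |f j|} a proper filter base.  An
    ultrafilter above it contains no initial segment of the indices, since f is
    bounded there. *)
Lemma unbounded_ultra {R : realType} {V : normedModType R} (f : nat -> V) :
  ~ bounded_set (range f) ->
  exists U : set_system nat, [/\ UltraFilter U, `|f j| @[j --> U] --> +oo &
    forall N, U [set j | (N <= j)%N]].
Proof.
move=> fub; pose G := filter_from [set: R] (fun K => [set j | K < `|f j|]).
have FG : Filter G.
  apply: filter_fromT_filter; first by exists 0.
  move=> K L; exists (Num.max K L) => j /=.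
  by rewrite gt_max => /andP[].
have PG : ProperFilter G.
  apply: filter_from_proper => K _; apply: contrapT => /forallNP noj.
  apply: fub; exists K; split; first exact: num_real.
  move=> L KL _ [j _ <-] /=; rewrite (le_trans _ (ltW KL)) // leNgt.
  by apply/negP; exact: noj.
have [U [UU GU]] := ultraFilterLemma PG; exists U; split => //.
  by apply/cvgryPgt => K; apply: GU; exists K.
move=> N; apply: GU; exists (\sum_(i < N) `|f i|) => // j /=.
apply: contraTT; rewrite -ltnNge -leNgt => jN.
by rewrite (bigD1 (Ordinal jN)) //= lerDl sumr_ge0.
Qed.

Lemma proper_subseq {F : set_system nat} {PF : ProperFilter F} (S : nat -> set nat) :
  (forall N, F [set j | (N <= j)%N]) -> (forall n, F (S n)) ->
  exists phi : nat -> nat, {homo phi : i j / (i < j)%N} /\ forall n, S n (phi n).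
Proof.
move=> Finf FS.
have /choice[g gP] : forall nN : nat * nat, exists j, (nN.2 <= j)%N /\ S nN.1 j.
  by move=> [n N]; have [j []] := filter_ex (filterI (Finf N) (FS n)); exists j.
pose phi := fix phi n := if n is k.+1 then g (n, (phi k).+1) else g (0, 0)%N.
exists phi; split; last first.
  by case=> [|n]; [exact: (gP (0, 0)%N).2|exact: (gP (n.+1, (phi n).+1)).2].
apply: homo_ltn => [y x z|n]; first exact: ltn_trans.
exact: (gP (n.+1, (phi n).+1)).1.
Qed.

End Ultrafilters.

(** * The endpoints *)

Section Endpoints.
Context {R : realType} (m : nat).
Hypothesis hm : (2 <= m)%N.

Definition limit_points : set (R * R * R) :=
  if odd m then [set p_minus R; n_plus R; n_minus R]
  else [set p_plus R; p_minus R; n_plus R; n_minus R].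

Let p_minus_in : limit_points (p_minus R).
Proof. by rewrite /limit_points; case: (odd m); rewrite /=; tauto. Qed.
Let n_plus_in : limit_points (n_plus R).
Proof. by rewrite /limit_points; case: (odd m); rewrite /=; tauto. Qed.
Let n_minus_in : limit_points (n_minus R).
Proof. by rewrite /limit_points; case: (odd m); rewrite /=; tauto. Qed.
Let p_plus_in : ~~ odd m -> limit_points (p_plus R).
Proof. by rewrite /limit_points => /negPf ->; rewrite /=; tauto. Qed.

Lemma ultra_catenoid_limit {T : Type} {U : set_system T} (zeta : T -> R * R) :
  UltraFilter U -> (\forall j \near U, Omega (zeta j)) ->
  `|catenoid_map m (zeta j)| @[j --> U] --> +oo ->
  exists2 p, limit_points p & hollow_ball (catenoid_map m (zeta j)) @[j --> U] --> p.
Proof.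
move=> UU Om foo.
have [h|h|[r0 h]] := ultra_catenoid_trichotomy hm UU Om foo.
- by exists (n_minus R) => //; exact: hollow_ball_catenoid_cvgy.
- exists (if odd m then n_minus R else p_plus R); last first.
    exact: hollow_ball_catenoid_cvgNy.
  by case: ifPn => // /p_plus_in.
have [Ap An Bp Bn] := hollow_ball_catenoid_cvg0 hm r0 foo.
case: h => h.
- by exists (p_minus R) => //; exact: Ap.
- by exists (if odd m then p_minus R else n_plus R); [case: ifP|exact: An].
- by exists (n_plus R) => //; exact: Bp.
- by exists (if odd m then n_plus R else p_minus R); [case: ifP|exact: Bn].
Qed.

Lemma limit_point_boundary p :
  limit_points p -> ideal_boundary_pos p \/ ideal_boundary_neg p.
Proof.
have s1 : 0 <= Num.sqrt 2 - 1 :> R.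
  by rewrite subr_ge0 -[leLHS]sqrtr1 ler_sqrt // ler1n.
have s2 : 0 <= Num.sqrt 2 + 1 :> R by rewrite addr_ge0 ?sqrtr_ge0.
have n0 (z : R) : norm3 (0, 0, z) = `|z|.
  by rewrite /norm3 !expr0n /= !add0r sqrtr_sqr.
have pp : ideal_boundary_pos (p_plus R).
  by rewrite /ideal_boundary_pos /mkset /p_plus n0 ger0_norm.
have pm : ideal_boundary_pos (p_minus R).
  by rewrite /ideal_boundary_pos /mkset /p_minus n0 normrN ger0_norm.
have np : ideal_boundary_neg (n_plus R).
  by rewrite /ideal_boundary_neg /mkset /n_plus n0 ger0_norm.
have nm : ideal_boundary_neg (n_minus R).
  by rewrite /ideal_boundary_neg /mkset /n_minus n0 normrN ger0_norm.
rewrite /limit_points; case: (odd m) => /=.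
  by move=> [[->|->]|->]; tauto.
by move=> [[[->|->]|->]|->]; tauto.
Qed.

Lemma norm_time_le (X : R * R * R * R) : `|X.1.1.1| <= `|X|.
Proof. by rewrite !prod_normE !le_max lexx. Qed.

Lemma lightline_sphere k t x y z : (k < 2 * m)%N -> lightline m k (t, x, y, z) ->
  [/\ z = - t, `|x| <= 1 & `|y| <= 1 :> R].
Proof.
move=> km Lk; have : deSitter (t, x, y, z).
  by apply: (catenoid_sub_deSitter hm); right; exists k.
have -> : z = - t by case: Lk => u _ [<- _ _ <-].
rewrite /deSitter /lorentz /= => dS.
have x2 := sqr_ge0 x; have y2 := sqr_ge0 y.
by split=> //; rewrite -[leRHS](@normr1 R) -ler_sqr ?nnegrE //
  !real_normK ?num_real //; lra.
Qed.

(** A point of the closure is the limit of the projection along an ultrafilter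
    on the catenoid; the ultrafilter concentrates either on the image of the
    map or on the union of the light-like lines. *)
Lemma endpoints_catenoid_sub : endpoints (@catenoid R m) `<=` limit_points.
Proof.
move=> xi [/closure_image_ultra[U [UU UA Uxi]] bxi].
have PU := @ultra_proper _ _ UU.
have too : `|X.1.1.1| @[X --> U] --> +oo.
  apply: (hollow_ball_cvg_boundary _ Uxi bxi).
  by apply: filterS UA; exact: catenoid_sub_deSitter.
suff [p Ep Up] : exists2 p, limit_points p & hollow_ball X @[X --> U] --> p.
  by rewrite (cvg_unique (@norm_hausdorff _ _) Uxi Up).
have [Uf|UNf] := in_ultra_setVsetC (catenoid_map m @` @Omega R) UU.
  have /choice[zeta zetaP] : forall X : R * R * R * R, exists p : R * R,
      (catenoid_map m @` @Omega R) X -> Omega p /\ catenoid_map m p = X.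
    move=> X; have [[p Op pX]|] := pselect ((catenoid_map m @` @Omega R) X).
      by exists p.
    by exists 0.
  have [||p Ep Up] := @ultra_catenoid_limit _ U zeta UU.
  - by apply: filterS Uf => X /zetaP[].
  - apply: ger_cvgy too; apply: filterS Uf => X /zetaP[_ ->].
    exact: norm_time_le.
  exists p => //; apply: cvg_trans Up; apply: near_eq_cvg.
  by apply: filterS Uf => X /zetaP[_ ->].
have UL : \forall X \near U, [/\ X.2 = - X.1.1.1, `|X.1.1.2| <= 1 & `|X.1.2| <= 1].
  apply: filterS2 UA UNf => -[[[t x] y] z] [//|[k km Lk] _].
  exact: (lightline_sphere km Lk).
have lim (b : bool) : (\forall X \near U, `|X.1.1.1| = (-1) ^+ b * X.1.1.1) ->
    hollow_ball X @[X --> U] --> if b then n_plus R else p_minus R.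
  move=> tb; have := @null_line_hollow_ball_cvg R _ U _ b
    (fun X => X.1.1.1) (fun X => X.1.1.2) (fun X => X.1.2) tb too.
  have xb : \forall X \near U, `|X.1.1.2| <= 1 by apply: filterS UL => X [].
  have yb : \forall X \near U, `|X.1.2| <= 1 by apply: filterS UL => X [].
  move=> /(_ _ xb yb); apply: cvg_trans; apply: near_eq_cvg.
  by apply: filterS UL => -[[[t x] y] z] /= [->].
have [tp|tn] := in_ultra_setVsetC [set X : R * R * R * R | 0 <= X.1.1.1] UU.
  exists (p_minus R) => //; apply: (lim false).
  by apply: filterS tp => X /= t0; rewrite mul1r ger0_norm.
exists (n_plus R) => //; apply: (lim true).
apply: filterS tn => X /= /negP; rewrite -ltNge => t0.
by rewrite expr1 mulN1r ltr0_norm.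
Qed.

(** Only the limits r to +oo and r to -oo are needed from the map itself: the
    light-like lines already reach p_- and n_+. *)
Lemma limit_points_sub_endpoints : limit_points `<=` endpoints (@catenoid R m).
Proof.
suff cl p : limit_points p -> closure (@hollow_ball R @` @catenoid R m) p.
  by move=> p Ep; split; [exact: cl|exact: limit_point_boundary].
have ray (F : set_system R) (PF : ProperFilter F) :
    (\forall r \near F, r != 0) -> forall p,
    hollow_ball (catenoid_map m (r, 0)) @[r --> F] --> p ->
    closure (@hollow_ball R @` @catenoid R m) p.
  move=> F0 q; apply: near_cvg_closure; apply: filterS F0 => r r0.
  exists (catenoid_map m (r, 0)) => //; left; exists (r, 0) => //.
  by move: r0; rewrite neq_lt => /orP[]; [right|left].
have nmC : closure (@hollow_ball R @` @catenoid R m) (n_minus R).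
  apply: (ray +oo _); first by near=> r; rewrite gt_eqF //.
  apply: (@hollow_ball_catenoid_cvgy _ _ hm _ (pinfty_nbhs R) _ (fun r => (r, 0))).
  exact: cvg_id.
have ppC : ~~ odd m -> closure (@hollow_ball R @` @catenoid R m) (p_plus R).
  move=> /negPf mo; apply: (ray -oo _); first by near=> r; rewrite lt_eqF //.
  have := @hollow_ball_catenoid_cvgNy _ _ hm _ (ninfty_nbhs R) _ (fun r => (r, 0)).
  by rewrite mo; apply; exact: cvg_id.
have line (F : set_system R) (PF : ProperFilter F) (b : bool) :
    (\forall t \near F, `|t| = (-1) ^+ b * t) -> `|t| @[t --> F] --> +oo ->
    closure (@hollow_ball R @` @catenoid R m) (if b then n_plus R else p_minus R).
  move=> tb too.
  pose x := complex.Re (gamma m (alpha R m 0)).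
  pose y := complex.Im (gamma m (alpha R m 0)).
  have L0 t : lightline m 0 (t, x, y, - t) by exists t.
  have m20 : (0 < 2 * m)%N by rewrite muln_gt0 /= ltnW.
  have [_ x1 y1] := lightline_sphere m20 (L0 0).
  apply: (near_cvg_closure _ (null_line_hollow_ball_cvg tb too
    (nearW _ (fun=> x1)) (nearW _ (fun=> y1)))).
  by apply: nearW => t; exists (t, x, y, - t) => //; right; exists 0%N.
have pmC : closure (@hollow_ball R @` @catenoid R m) (p_minus R).
  apply: (line +oo _ false); last by apply: cvgy_norm_cvgy; exact: cvg_id.
  by near=> t; rewrite mul1r gtr0_norm.
have npC : closure (@hollow_ball R @` @catenoid R m) (n_plus R).
  apply: (line -oo _ true); last by apply: cvgNy_norm_cvgy; exact: cvg_id.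
  by near=> t; rewrite expr1 mulN1r ltr0_norm.
rewrite /limit_points; case: ifPn => [_|/ppC ppC'] /=.
  by move=> [[->|->]|->].
by move=> [[[->|->]|->]|->].
Unshelve. all: by end_near. Qed.

End Endpoints.

(** * Subsequences of an unbounded sequence *)

Lemma cvgy_natr_lt {R : realType} (u : nat -> R) :
  (forall n, n%:R < u n) -> u j @[j --> \oo] --> +oo.
Proof.
by move=> nu; apply: ger_cvgy (@cvgr_idn R); apply: nearW => n; rewrite ltW.
Qed.

(** The trichotomy holds along an ultrafilter on the indices.  It gives, for
    every n, arbitrarily large indices at which the required estimates hold with
    accuracy n; selecting one of them for each n realises the same case. *)
Lemma catenoid_subseq {R : realType} (m : nat) (hm : (2 <= m)%N) (zeta : nat -> R * R) :
  (forall j, Omega (zeta j)) ->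
  ~ bounded_set (range (fun j => catenoid_map m (zeta j))) ->
  exists phi : nat -> nat,
    [/\ {homo phi : i j / (i < j)%N},
        diverges (fun j => catenoid_map m (zeta (phi j))) &
        [\/ (zeta (phi j)).1 @[j --> \oo] --> +oo,
            (zeta (phi j)).1 @[j --> \oo] --> -oo |
            (zeta (phi j)).1 @[j --> \oo] --> (0 : R) /\
            [\/ forall j, A_pos m (zeta (phi j)),
                forall j, A_neg m (zeta (phi j)),
                forall j, B_pos m (zeta (phi j)) |
                forall j, B_neg m (zeta (phi j))]]].
Proof.
move=> Om /unbounded_ultra[U [UU foo Uinf]].
have PU := @ultra_proper _ _ UU.
have subseq (Q : nat -> set nat) : (forall n, U (Q n)) -> exists phi : nat -> nat,
    [/\ {homo phi : i j / (i < j)%N},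
        diverges (fun j => catenoid_map m (zeta (phi j))) &
        forall n, Q n (phi n)].
  move=> UQ.
  have [|phi [phi_homo phiP]] := @proper_subseq U _
      (fun n => [set j | n%:R < `|catenoid_map m (zeta j)|] `&` Q n) Uinf.
    by move=> n; apply: filterI => //; exact: cvgry_gt.
  exists phi; split => //; last by move=> n; have [] := phiP n.
  by apply: cvgy_natr_lt => n; have [] := phiP n.
have [roo|roo|[r0 dom]] := ultra_catenoid_trichotomy hm UU (nearW _ Om) foo.
- have [|phi [phi_homo fphi phiP]] := subseq (fun n => [set j | n%:R < (zeta j).1]).
    by move=> n; exact: cvgry_gt.
  exists phi; split => //; apply: Or31; exact: cvgy_natr_lt.
- have [|phi [phi_homo fphi phiP]] := subseq (fun n => [set j | n%:R < - (zeta j).1]).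
    by move=> n; near=> j; rewrite /= ltrNr; near: j; exact: cvgrNy_lt.
  exists phi; split => //; apply: Or32; apply/cvgNry; exact: cvgy_natr_lt.
have dom_subseq (D : set (R * R)) : (\forall j \near U, D (zeta j)) ->
    exists phi : nat -> nat,
    [/\ {homo phi : i j / (i < j)%N},
        diverges (fun j => catenoid_map m (zeta (phi j))),
        (zeta (phi j)).1 @[j --> \oo] --> (0 : R) &
        forall n, D (zeta (phi n))].
  move=> UD; have [|phi [phi_homo fphi phiP]] :=
      subseq (fun n => [set j | `|(zeta j).1| < n.+1%:R^-1] `&` [set j | D (zeta j)]).
    by move=> n; apply: filterI => //; apply: cvgr0_norm_lt => //; rewrite invr_gt0.
  exists phi; split => //; last by move=> n; have [] := phiP n.
  apply: norm_cvg0; apply: (squeeze_cvgr _ (cvg_cst 0) (@cvg_harmonic R)).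
  by apply: nearW => n; rewrite normr_ge0 /= ltW //; have [] := phiP n.
case: dom => /dom_subseq[phi [phi_homo fphi rphi phiP]]; exists phi; split => //;
  apply: Or33; split => //.
- exact: Or41.
- exact: Or42.
- exact: Or43.
- exact: Or44.
Unshelve. all: by end_near. Qed.

Theorem theorem3 (R : realType) (m : nat) (hm : (2 <= m)%N) :
  endpoints (@catenoid R m) =
    (if odd m then [set p_minus R; n_plus R; n_minus R]
     else [set p_plus R; p_minus R; n_plus R; n_minus R])
  /\
  forall zeta : nat -> R * R,
    (forall j, Omega (zeta j)) ->
    ~ bounded_set (range (fun j => catenoid_map m (zeta j))) ->
    let y := fun j => hollow_ball (catenoid_map m (zeta j)) in
    [/\ (* exhaustiveness of the cases, up to a subsequence *)
        exists phi : nat -> nat,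
          [/\ {homo phi : i j / (i < j)%N},
              diverges (fun j => catenoid_map m (zeta (phi j))) &
              [\/ (zeta (phi j)).1 @[j --> \oo] --> +oo,
                  (zeta (phi j)).1 @[j --> \oo] --> -oo |
                  (zeta (phi j)).1 @[j --> \oo] --> (0 : R) /\
                  [\/ forall j, A_pos m (zeta (phi j)),
                      forall j, A_neg m (zeta (phi j)),
                      forall j, B_pos m (zeta (phi j)) |
                      forall j, B_neg m (zeta (phi j))]]],
        (* (1) *)
        (zeta j).1 @[j --> \oo] --> +oo -> y @ \oo --> n_minus R,
        (* (2) *)
        (zeta j).1 @[j --> \oo] --> -oo ->
          y @ \oo --> (if odd m then n_minus R else p_plus R) &
        (* (3) *)
        (zeta j).1 @[j --> \oo] --> (0 : R) ->
        diverges (fun j => catenoid_map m (zeta j)) ->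
        [/\ (forall j, A_pos m (zeta j)) -> y @ \oo --> p_minus R,
            (forall j, A_neg m (zeta j)) ->
              y @ \oo --> (if odd m then p_minus R else n_plus R),
            (forall j, B_pos m (zeta j)) -> y @ \oo --> n_plus R &
            (forall j, B_neg m (zeta j)) ->
              y @ \oo --> (if odd m then n_plus R else p_minus R)]].
Proof.
split.
  apply/seteqP; split; first exact: endpoints_catenoid_sub.
  exact: limit_points_sub_endpoints.
move=> zeta Om fub y; split.
- exact: catenoid_subseq.
- exact: hollow_ball_catenoid_cvgy.
- exact: hollow_ball_catenoid_cvgNy.
move=> r0 foo; have [Ap An Bp Bn] := hollow_ball_catenoid_cvg0 hm r0 foo.
by split => dom; [apply: Ap|apply: An|apply: Bp|apply: Bn]; exact: nearW.
Qed.
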